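(* There is a constant $C<\infty$ such that the following holds. Suppose $f:I\to\mathbb{R}$ is a continuous function on a compact interval $I\subset\mathbb{R}$. Then for any $\epsilon>0$ there is a polynomial $p$ with real coefficients such that $\|f-p\|_I<\epsilon$ and $\mathrm{CP}(p)\subset I$, i.e., every real or complex critical point of $p$ lies in $I$. Moreover, if $f$ is $A$-Lipschitz on $I$ for some $A>0$, then $p$ may in addition be taken to be $CA$-Lipschitz on $I$, where $C$ does not depend on $f$.
   Context: $\|g\|_I=\sup_{x\in I}|g(x)|$. $\mathrm{CP}(p)=\{z\in\mathbb{C}: p'(z)=0\}$. A function $f$ is $A$-Lipschitz on $I$ if $|f(x)-f(y)|\le A|x-y|$ for all $x,y\in I$. *)

(* Defs.v *)
From HB Require Import structures.
From mathcomp Require Import all_boot all_order all_algebra.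
From mathcomp Require Import all_classical all_reals all_analysis.
From mathcomp Require Export complex.

Set Implicit Arguments.
Unset Strict Implicit.
Unset Printing Implicit Defensive.

Import Order.TTheory GRing.Theory Num.Theory.
Import numFieldNormedType.Exports.

Local Open Scope classical_set_scope.
Local Open Scope ring_scope.
Local Open Scope complex_scope.

(* [sup] takes the value 0 on an empty or unbounded set, so this is only
   meaningful when [g] is bounded on the nonempty set [I]. *)
Definition supnorm (R : realType) (I : set R) (g : R -> R) : R :=
  sup [set `|g x| | x in I].

(* When [p] is constant, this is the whole complex plane. *)
Definition CP (R : realType) (p : {poly R[i]}) : set R[i] :=
  [set z | p^`().[z] = 0].

Definition complex_poly (R : realType) (p : {poly R}) : {poly R[i]} :=
  map_poly (real_complex R) p.

Definition complex_set (R : realType) (I : set R) : set R[i] :=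
  [set x%:C | x in I].

(* Main.v *)
Require Import Defs.
From HB Require Import structures.
From mathcomp Require Import all_boot all_order all_algebra.
From mathcomp Require Import all_classical all_reals all_analysis.
From mathcomp Require Import polyrcf ring lra.

Import Order.TTheory GRing.Theory Num.Theory.
Import numFieldNormedType.Exports.

Local Open Scope classical_set_scope.
Local Open Scope ring_scope.

(* If [T_n] is the Chebyshev polynomial and [q] is a polynomial of degree less
   than [n] with [|q| < D] on [-1, 1], then [q + D T_n] has the sign of
   [(-1)^i] at the [n + 1] points [cos (i pi / n)], so that its [n] complex
   roots are real and lie in [-1, 1]. Its antiderivative stays within [O (D / n)]
   of that of [q], because [T_n] has the antiderivative
   [(T_(n+1) / (n + 1) - T_(n-1) / (n - 1)) / 2]. Taking for [q] the derivative
   of a Bernstein polynomial [P] of [f], rescaled to [a, b], gives the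
   approximation; if [f] is [A]-Lipschitz then [|P'| <= A], and [D = 2 A]
   yields [C = 4]. *)

(** * Bernstein polynomials *)

(* De Casteljau's recursion for [\sum_k c_k 'C(m, k) 'X^k (1 - 'X)^(m - k)]. *)
Fixpoint casteljau {R : comNzRingType} (m : nat) (c : nat -> R) : {poly R} :=
  if m is m'.+1 then
    (1 - 'X) * casteljau m' c + 'X * casteljau m' (fun k => c k.+1)
  else (c 0)%:P.

Lemma casteljauB (R : comNzRingType) (m : nat) (c d : nat -> R) :
  casteljau m (fun k => c k - d k) = casteljau m c - casteljau m d.
Proof.
elim: m c d => [|m IH] c d /=; first by rewrite polyCB.
by rewrite !IH; ring.
Qed.

(** Differentiation becomes a forward difference of the coefficients; this carries a Lipschitz bound
    on [f] over to its Bernstein polynomial. *)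
Lemma deriv_casteljau (R : comNzRingType) (m : nat) (c : nat -> R) :
  (casteljau m.+1 c)^`() = m.+1%:R * casteljau m (fun k => c k.+1 - c k).
Proof.
elim: m c => [|m IH] c.
  by rewrite /= derivD !derivM derivB derivX !derivC polyCB; ring.
rewrite [casteljau m.+2 c]/= -/(casteljau m.+1 _) -/(casteljau m.+1 (fun k => _)).
rewrite derivD !derivM derivB derivX derivC !IH [in RHS]/= !casteljauB.
rewrite [in RHS]mulrS /=.
by ring.
Qed.

Lemma horner_casteljauS (R : comNzRingType) (m : nat) (c : nat -> R) (t : R) :
  (casteljau m.+1 c).[t] =
  (1 - t) * (casteljau m c).[t] + t * (casteljau m (fun k => c k.+1)).[t].
Proof. by rewrite /= !hornerE. Qed.

(** For [t] in [0, 1], each step of the recursion is a convex combination, hence monotone. *)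
Lemma ler_casteljau (R : realType) (m : nat) (c d : nat -> R) (t : R) :
  0 <= t <= 1 -> (forall k, (k <= m)%N -> c k <= d k) ->
  (casteljau m c).[t] <= (casteljau m d).[t].
Proof.
move=> /andP[t0 t1]; elim: m c d => [|m IH] c d cd.
  by rewrite !hornerC cd.
rewrite !horner_casteljauS lerD// ler_wpM2l ?subr_ge0//; apply: IH => k km.
  by apply: cd; exact: leqW.
exact: cd.
Qed.

(* For [u = 0] and [v = 1] this is the second moment, around [s], of the
   binomial distribution of parameters [m] and [t]. *)
Lemma casteljau_square (R : realType) (m : nat) (u v s t : R) :
  (casteljau m (fun k => u + v * (k%:R - s) ^+ 2)).[t] =
  u + v * ((m%:R * t - s) ^+ 2 + m%:R * t * (1 - t)).
Proof.
elim: m s => [|m IH] s; first by rewrite hornerC; ring.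
rewrite horner_casteljauS IH.
have -> : (fun k => u + v * (k.+1%:R - s) ^+ 2) =
          (fun k => u + v * (k%:R - (s - 1)) ^+ 2).
  by apply/funext => k; rewrite -natr1; ring.
by rewrite IH -natr1; ring.
Qed.

Lemma horner_affine (R : realType) (p : {poly R}) (k l x : R) :
  (p \Po (k *: 'X + l%:P)).[x] = p.[k * x + l].
Proof. by rewrite horner_comp !hornerE. Qed.

Lemma deriv_affine (R : realType) (p : {poly R}) (k l : R) :
  (p \Po (k *: 'X + l%:P))^`() = k *: (p^`() \Po (k *: 'X + l%:P)).
Proof.
by rewrite deriv_comp derivD derivZ derivX derivC addr0 alg_polyC mulrC mul_polyC.
Qed.

Lemma size_affine_leq (R : realType) (p : {poly R}) (k l : R) :
  (size (p \Po (k *: 'X + l%:P)) <= size p)%N.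
Proof.
have [->|p0] := eqVneq p 0; first by rewrite comp_poly0.
have sq : ((size (k *: 'X + l%:P)%R).-1 <= 1)%N.
  rewrite -subn1 leq_subLR; apply: leq_trans (size_polyD _ _) _; rewrite geq_max.
  rewrite (leq_trans (size_scale_leq _ _)) ?size_polyX//.
  by rewrite (leq_trans (size_polyC_leq1 _)).
apply: leq_trans (size_comp_poly_leq _ _) _.
rewrite -[leqRHS]prednK ?size_poly_gt0// ltnS -[leqRHS]muln1 leq_mul2l.
by rewrite sq orbT.
Qed.

(** Averaging the quadratic bound against the binomial weights leaves [e] plus [K] times a variance
    of order [1 / m]. The derivative averages difference quotients of [f] at neighbouring nodes, so
    it inherits any Lipschitz constant. *)
Lemma bernstein_approx (R : realType) (a b e K : R) (f : R -> R) :
  a < b -> 0 < e -> 0 <= K ->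
  {in `[a, b] &, forall x y, `|f x - f y| <= e + K * (x - y) ^+ 2} ->
  exists P : {poly R}, {in `[a, b], forall x, `|f x - P.[x]| <= e *+ 2} /\
    forall A, {in `[a, b] &, forall x y, `|f x - f y| <= A * `|x - y|} ->
      {in `[a, b], forall x, `|P^`().[x]| <= A}.
Proof.
move=> ab e0 K0 fK.
(* This makes [m] exceed [K (b - a)^2 / e], so that the variance term is at most [e]. *)
pose n := Num.truncn (K * (b - a) ^+ 2 / e); pose m := n.+1.
have ba0 : 0 < b - a by rewrite subr_gt0.
have m0 : 0 < m%:R :> R by rewrite ltr0n.
have Km : K * (b - a) ^+ 2 <= e * m%:R.
  by rewrite -ler_pdivrMl// mulrC ltW// truncnS_gt.
pose h := (b - a) / m%:R; pose X k : R := a + k%:R * h.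
have h0 : 0 < h by rewrite divr_gt0.
have Xab k : (k <= m)%N -> X k \in `[a, b].
  move=> km; rewrite in_itv /= lerDl mulr_ge0 ?(ltW h0)//=.
  rewrite -lerBrDl /h mulrCA -[leRHS]mulr1 ler_wpM2l ?(ltW ba0)//.
  by rewrite ler_pdivrMr// mul1r ler_nat.
pose k := (b - a)^-1; pose l := - a / (b - a).
pose P := casteljau m (fun i => f (X i)) \Po (k *: 'X + l%:P).
have kl x : x \in `[a, b] -> 0 <= k * x + l <= 1.
  rewrite in_itv /= => /andP[ax xb].
  have -> : k * x + l = (x - a) / (b - a) by rewrite /k /l; field; rewrite gt_eqF.
  by rewrite divr_ge0 ?ler_pdivrMr ?mul1r ?lerD2r ?subr_ge0// ltW.
exists P; split=> [x xab|A fA x xab].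
  rewrite horner_affine; set t := k * x + l.
  have /andP[t0 t1] := kl x xab; rewrite -/t in t0 t1.
  have hx i : (X i - x) ^+ 2 = h ^+ 2 * (i%:R - m%:R * t) ^+ 2.
    rewrite -exprMn; congr (_ ^+ 2); rewrite /X /t /k /l /h.
    by field; rewrite !gt_eqF.
  have var : K * h ^+ 2 * (m%:R * t * (1 - t)) <= e.
    apply: (@le_trans _ _ (K * h ^+ 2 * m%:R)).
      rewrite ler_wpM2l ?(mulr_ge0 K0 (sqr_ge0 h))// -mulrA ler_piMr ?ltW//.
      nra.
    rewrite (_ : _ * m%:R = K * (b - a) ^+ 2 / m%:R) ?ler_pdivrMr//.
    by rewrite /h; field; rewrite gt_eqF.
  have cf i : (i <= m)%N -> `|f (X i) - f x| <=
      e + K * h ^+ 2 * (i%:R - m%:R * t) ^+ 2.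
    by move=> im; rewrite -mulrA -hx fK// Xab.
  (* The coefficients lie between two quadratics centred at [m t], the mean of the binomial
     distribution; there only the variance [m t (1 - t)] survives. *)
  have up : (casteljau m (fun i => f (X i))).[t] <= f x + e + e.
    apply: (@le_trans _ _ (casteljau m (fun i =>
      f x + e + K * h ^+ 2 * (i%:R - m%:R * t) ^+ 2)).[t]).
      apply: ler_casteljau => [|i im]; first by rewrite t0.
      by have := cf i im; rewrite ler_norml => /andP[_]; lra.
    by rewrite casteljau_square subrr expr0n add0r; lra.
  have lo : f x - e - e <= (casteljau m (fun i => f (X i))).[t].
    apply: (@le_trans _ _ (casteljau m (fun i =>
      f x - e + (- (K * h ^+ 2)) * (i%:R - m%:R * t) ^+ 2)).[t]).
      by rewrite casteljau_square subrr expr0n add0r; lra.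
    apply: ler_casteljau => [|i im]; first by rewrite t0.
    by have := cf i im; rewrite ler_norml => /andP[+ _]; lra.
  by rewrite ler_norml; apply/andP; split; lra.
rewrite deriv_affine hornerZ horner_affine deriv_casteljau.
set t := k * x + l; have t01 := kl x xab; rewrite -/t in t01.
have dX i : (i <= n)%N -> `|f (X i.+1) - f (X i)| <= A * h.
  move=> im; apply: le_trans (fA _ _ (Xab _ _) (Xab _ _)) _ => //.
    exact: leqW.
  by rewrite /X -natr1 (_ : _ - _ = h) ?gtr0_norm//; ring.
have up : (casteljau n (fun i => f (X i.+1) - f (X i))).[t] <= A * h.
  (* With [v = 0] the second-moment formula says that constant coefficients give a constant. *)
  have := casteljau_square R n (A * h) 0 0 t; rewrite mul0r addr0 => <-.
  apply: ler_casteljau => // i im; rewrite mul0r addr0.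
  by have := dX i im; rewrite ler_norml => /andP[].
have lo : - (A * h) <= (casteljau n (fun i => f (X i.+1) - f (X i))).[t].
  have := casteljau_square R n (- (A * h)) 0 0 t; rewrite mul0r addr0 => <-.
  apply: ler_casteljau => // i im; rewrite mul0r addr0.
  by have := dX i im; rewrite ler_norml => /andP[].
have -> : A = k * (m%:R * (A * h)).
  by rewrite /k /h; field; rewrite !gt_eqF.
rewrite hornerM -(rmorph_nat (@polyC R)) hornerC !normrM.
rewrite gtr0_norm ?invr_gt0// gtr0_norm// !ler_wpM2l ?invr_ge0 ?(ltW ba0) ?(ltW m0)//.
by rewrite ler_norml lo up.
Qed.

(** * Chebyshev polynomials *)

(* The pair [(T_n, U_(n-1))]: with [x = cos t], the recursion is the addition
   formula for [(cos (n t), sin (n t) / sin t)], so no division is needed. *)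
Fixpoint chebyshev (R : comNzRingType) (n : nat) : {poly R} * {poly R} :=
  if n is n'.+1 then
    let: (T, V) := chebyshev R n' in
    ('X * T - (1 - 'X^2) * V, 'X * V + T)
  else (1, 0).

Notation chebT R n := (chebyshev R n).1.
Notation chebV R n := (chebyshev R n).2.

Lemma chebTS (R : comNzRingType) n :
  chebT R n.+1 = 'X * chebT R n - (1 - 'X^2) * chebV R n.
Proof. by rewrite /=; case: (chebyshev R n). Qed.

Lemma chebVS (R : comNzRingType) n :
  chebV R n.+1 = 'X * chebV R n + chebT R n.
Proof. by rewrite /=; case: (chebyshev R n). Qed.

Lemma size_chebyshev (R : comNzRingType) n :
  (size (chebT R n) <= n.+1)%N /\ (size (chebV R n) <= n)%N.
Proof.
elim: n => [|n [IHT IHV]]; first by rewrite size_poly1 size_poly0.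
have sX (p : {poly R}) k : (size p <= k)%N -> (size ('X * p)%R <= k.+1)%N.
  move=> pk; apply: leq_trans (size_polyMleq _ _) _.
  by rewrite size_polyX /= ltnS.
rewrite chebTS chebVS; split.
  rewrite mulrBl mul1r expr2 -mulrA; apply: leq_trans (size_polyD _ _) _.
  rewrite geq_max sX// size_polyN (leq_trans (size_polyD _ _))// size_polyN.
  by rewrite geq_max !sX// (leq_trans IHV)// ltnW.
by apply: leq_trans (size_polyD _ _) _; rewrite geq_max sX.
Qed.

(** The second identity is the derivative of [sin (n t) = sin t * V (cos t)]. The two are proved
    together because the first at [n + 1] uses the second at [n]. *)
Lemma deriv_chebyshev (R : comNzRingType) n :
  (chebT R n)^`() = n%:R * chebV R n /\
  (1 - 'X^2) * (chebV R n)^`() = 'X * chebV R n - n%:R * chebT R n.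
Proof.
elim: n => [|n [IHT IHV]].
  by rewrite /= derivC linear0; split; ring.
rewrite chebTS chebVS; split.
  rewrite derivB !derivM derivB derivXn derivX derivC IHT IHV /= -natr1.
  by ring.
rewrite derivD derivM derivX IHT -natr1.
transitivity ((1 - 'X^2) * chebV R n +
  'X * ((1 - 'X^2) * (chebV R n)^`()) + (1 - 'X^2) * (n%:R * chebV R n)).
  by ring.
by rewrite IHV; ring.
Qed.

(** This is [sin ((n + 2) t) - sin (n t) = 2 sin t cos ((n + 1) t)]; with [T_n' = n U_(n-1)] it
    provides the antiderivative of [T_(n+1)]. *)
Lemma chebV_chebT (R : comNzRingType) n :
  chebV R n.+2 - chebV R n = chebT R n.+1 *+ 2.
Proof. by rewrite (chebVS _ n.+1) chebVS chebTS; ring. Qed.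

Lemma chebT_cos (R : realType) n (t : R) :
  (chebT R n).[cos t] = cos (n%:R * t).
Proof.
suff [] : (chebT R n).[cos t] = cos (n%:R * t) /\
  sin t * (chebV R n).[cos t] = sin (n%:R * t) by [].
elim: n => [|n [IHT IHV]].
  by rewrite /= !hornerE cos0 sin0.
have -> : n.+1%:R * t = n%:R * t + t by rewrite -natr1; ring.
rewrite chebTS chebVS !hornerE IHT cosD sinD -IHV.
rewrite -[1](cos2Dsin2 t).
by split; ring.
Qed.

Lemma ler_norm_chebT (R : realType) n (x : R) :
  -1 <= x <= 1 -> `|(chebT R n).[x]| <= 1.
Proof.
move=> x1; have /= <- := @acosK R x; last by rewrite in_itv.
by rewrite chebT_cos ler_norml cos_geN1 cos_le1.
Qed.

Lemma cos_nat_pi (R : realType) n : cos (n%:R * pi) = (-1) ^+ n :> R.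
Proof.
by have := alternatingn (@cosDpi R) n 0; rewrite add0r cos0 mulr1 mulr_natl.
Qed.

(** * Real-rootedness *)

(** The intermediate value theorem gives one root in each of the [n] disjoint gaps. *)
Lemma alternating_roots (R : rcfType) (p : {poly R}) (x : nat -> R) n :
  (forall i, (i < n)%N -> x i.+1 < x i) ->
  (forall i, (i < n)%N -> p.[x i.+1] * p.[x i] < 0) ->
  exists rs : seq R, [/\ size rs = n, uniq rs, all (root p) rs &
                         {in rs, forall r, x n <= r <= x 0}].
Proof.
move=> xdec psgn.
(* The strict lower bound [x n < r] separates the earlier roots from the next one, which lies below
   [x n]. *)
suff [rs [srs urs rrs brs _]] : exists rs : seq R,
    [/\ size rs = n, uniq rs, all (root p) rs,
        {in rs, forall r, x n < r <= x 0} & x n <= x 0].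
  by exists rs; split=> // r /brs /andP[/ltW -> ->].
elim: n xdec psgn => [|n IH] xdec psgn; first by exists [::]; split.
have [i lin|i lin|rs [srs urs rrs brs xn0]] := IH.
- by apply: xdec; exact: ltnW.
- by apply: psgn; exact: ltnW.
have xSn := xdec n (ltnSn n).
have [r rin rootr] := poly_ivtoo (ltW xSn) (psgn n (ltnSn n)).
move: rin; rewrite in_itv /= => /andP[xr rx].
exists (r :: rs); split=> /=.
- by rewrite srs.
- rewrite urs andbT; apply/negP => /brs /andP[+ _].
  by rewrite ltNge (ltW rx).
- by rewrite rootr.
- move=> s; rewrite inE => /predU1P[->|/brs /andP[xs ->]].
    by rewrite xr (le_trans (ltW rx)).
  by rewrite andbT (lt_trans xSn).
- by rewrite (le_trans (ltW xSn)).
Qed.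

(** Any further root would give a nonzero polynomial more distinct roots than its degree. *)
Lemma complex_root_of_split (R : realType) (q : {poly R}) (rs : seq R)
    (z : R[i]) :
  q != 0 -> (size q <= (size rs).+1)%N -> uniq rs -> all (root q) rs ->
  root (complex_poly q) z -> exists2 r, r \in rs & z = r%:C%C.
Proof.
move=> q0 sq urs rrs rz.
have [/mapP[r rrs' ->]|zN] := boolP (z \in map (real_complex R) rs).
  by exists r.
have : (size (z :: map (real_complex R) rs) < size (complex_poly q))%N.
  apply: max_poly_roots.
  - by rewrite map_poly_eq0.
  - rewrite /= rz /=; apply/allP => _ /mapP[r rin ->].
    by rewrite /root horner_map (eqP (allP rrs r rin)).
  - by rewrite /= zN map_inj_uniq//; exact: complexI.
by rewrite /= size_map size_map_poly ltnNge sq.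
Qed.

(* [T_n] takes the values [1] and [-1] alternately at the [n + 1] points
   [cos (i pi / n)], and adding [q] does not change the signs there. *)
Lemma chebT_perturbation_roots (R : realType) (n : nat) (D : R) (q : {poly R}) :
  (0 < n)%N -> (forall x : R, -1 <= x <= 1 -> `|q.[x]| < D) ->
  exists rs : seq R, [/\ size rs = n, uniq rs,
    all (root (q + D *: chebT R n)) rs & {in rs, forall r : R, -1 <= r <= 1}].
Proof.
move=> n0 qD; pose x i : R := cos (i%:R * pi / n%:R).
have nR0 : 0 < n%:R :> R by rewrite ltr0n.
have x1 i : -1 <= x i <= 1 by rewrite cos_geN1 cos_le1.
have Tx i : (chebT R n).[x i] = (-1) ^+ i.
  by rewrite chebT_cos -cos_nat_pi; congr cos; field; rewrite gt_eqF.
have xin i : (i <= n)%N -> i%:R * pi / n%:R \in `[0, pi : R].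
  move=> lin; rewrite in_itv /= divr_ge0 ?mulr_ge0 ?pi_ge0//=.
  by rewrite ler_pdivrMr// mulrC ler_wpM2l ?pi_ge0// ler_nat.
have [i lin|i lin|rs [srs urs rrs brs]] :=
    @alternating_roots R (q + D *: chebT R n) x n.
- rewrite ltr_cos ?xin// 1?ltnW// ltr_pM2r ?invr_gt0// ltr_pM2r ?pi_gt0//.
  by rewrite ltr_nat.
- rewrite !hornerE !Tx exprS.
  have := qD _ (x1 i); have := qD _ (x1 i.+1); rewrite !ltr_norml.
  by rewrite -signr_odd; case: odd => /=; rewrite ?expr0 ?expr1; nra.
exists rs; split=> // r /brs /andP[rn r0].
move: (x1 n) (x1 0%N) => /andP[xn _] /andP[_ x0].
by rewrite (le_trans xn rn) (le_trans r0 x0).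
Qed.

(** Adding a small multiple of a rescaled antiderivative of [T_(n+2)] turns [P'] into
    [P' + D T_(n+2)], whose roots are all real and in the interval. *)
Lemma real_critical_approx (R : realType) (a b D e : R) (P : {poly R}) :
  a < b -> 0 < e -> {in `[a, b], forall x, `|P^`().[x]| < D} ->
  exists p : {poly R}, [/\ {in `[a, b], forall x, `|P.[x] - p.[x]| <= e},
    {in `[a, b], forall x, `|p^`().[x]| <= D *+ 2} &
    CP (complex_poly p) `<=` complex_set `[a, b]].
Proof.
move=> ab e0 PD.
have ba0 : 0 < b - a by rewrite subr_gt0.
have D0 : 0 < D.
  by apply: le_lt_trans (normr_ge0 _) (PD a _); rewrite in_itv /= lexx ltW.
(* The map [c x + d] sends [-1, 1] onto [a, b], and [k x + l] is its inverse. *)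
pose c := (b - a) / 2; pose d := (a + b) / 2; pose k := c^-1; pose l := - d / c.
have c0 : 0 < c by rewrite divr_gt0.
have kcl x : k * (c * x + d) + l = x by rewrite /k /l; field; rewrite gt_eqF.
have klb x : x \in `[a, b] -> -1 <= k * x + l <= 1.
  rewrite in_itv /= => /andP[ax xb].
  have -> : k * x + l = (x - d) / c by rewrite /k /l; field; rewrite gt_eqF.
  by rewrite ler_pdivlMr ?ler_pdivrMr// /c /d; apply/andP; split; lra.
have cdb x : -1 <= x <= 1 -> c * x + d \in `[a, b].
  rewrite in_itv /= /c /d => /andP[x1 x2].
  by apply/andP; split; nra.
(* The bound [n >= N] makes the correction at most [e]; [n >= size P] keeps the degree of [P'] below
   [n + 2]. *)
pose N := Num.truncn (D * c / e); pose n := maxn N (size P).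
have nN : D * c / n.+1%:R <= e.
  rewrite ler_pdivrMr ?ltr0n// -ler_pdivrMl// mulrC.
  rewrite (le_trans (ltW (truncnS_gt _)))// ler_nat ltnS; exact: leq_maxl.
pose W : {poly R} := n.+3%:R^-1 *: chebT R n.+3 - n.+1%:R^-1 *: chebT R n.+1.
have dW : W^`() = chebT R n.+2 *+ 2.
  have natK m (V : {poly R}) : m.+1%:R^-1 *: (m.+1%:R * V) = V.
    by rewrite mulr_natl -[V *+ _]scaler_nat scalerA mulVf ?scale1r// pnatr_eq0.
  by rewrite derivB !derivZ !(deriv_chebyshev R _).1 -chebV_chebT !natK.
have WE x : -1 <= x <= 1 -> `|W.[x]| <= 2 / n.+1%:R.
  move=> x1; rewrite hornerD hornerN !hornerZ; apply: le_trans (ler_normB _ _) _.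
  have -> : 2 / n.+1%:R = n.+1%:R^-1 * 1 + n.+1%:R^-1 * 1 :> R by ring.
  rewrite !normrM ![`|_^-1|]gtr0_norm ?invr_gt0 ?ltr0n//.
  apply: lerD; apply: ler_pM => //; rewrite ?invr_ge0//;
    try exact: ler_norm_chebT.
  by rewrite lef_pV2 ?posrE ?ltr0n// ler_nat ltnS leqW.
(* The factor [c / 2] cancels the [1 / c] of the chain rule and the 2 in [W' = 2 T_(n+2)]. *)
pose p := P + (D * c / 2) *: (W \Po (k *: 'X + l%:P)).
have dp : p^`() = P^`() + D *: (chebT R n.+2 \Po (k *: 'X + l%:P)).
  rewrite derivD derivZ deriv_affine dW scalerA
    -[chebT R _ *+ _]scaler_nat comp_polyZ scalerA.
  by congr (_ + _ *: _); rewrite /k; field; rewrite gt_eqF.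
exists p; split.
- move=> x /klb xk; rewrite hornerD hornerZ horner_affine opprD addrA subrr add0r.
  rewrite normrN normrM gtr0_norm ?divr_gt0 ?mulr_gt0//.
  apply: le_trans nN; rewrite (_ : D * c / n.+1%:R = D * c / 2 * (2 / n.+1%:R)).
    by rewrite ler_wpM2l ?WE// ltW// divr_gt0// mulr_gt0.
  by move: n.+1%:R^-1 => w; field.
- move=> x xab; rewrite dp hornerD hornerZ horner_affine mulr2n.
  apply: le_trans (ler_normD _ _) _; apply: lerD; first exact: ltW (PD x xab).
  by rewrite normrM gtr0_norm// ler_piMr ?(ltW D0)// ler_norm_chebT// klb.
pose q := P^`() \Po (c *: 'X + d%:P).
have [x x1|rs [srs urs rrs brs]] := @chebT_perturbation_roots R n.+2 D q isT.
  by rewrite horner_affine; apply/PD/cdb.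
move=> z; rewrite /CP /= /complex_poly deriv_map => pz.
have [|||||_ /mapP[r rin ->] ->] :=
    @complex_root_of_split R p^`() (map (fun r => c * r + d) rs) z.
(* At [b] the Chebyshev term equals [D], as [T_(n+2)(1) = 1], and [|P'(b)| < D]; so [p'] is not
   zero. *)
- apply/eqP => p'0; have b1 : -1 <= (1 : R) <= 1 by apply/andP; split; lra.
  have := PD _ (cdb 1 b1); rewrite ltr_norml => /andP[+ _].
  have : p^`().[c * 1 + d] = 0 by rewrite p'0 horner0.
  rewrite dp hornerD hornerZ horner_affine kcl -[X in (chebT R _).[X]]cos0.
  by rewrite chebT_cos mulr0 cos0 mulr1; lra.
- rewrite size_map srs dp; apply: leq_trans (size_polyD _ _) _.
  rewrite geq_max; apply/andP; split.
    have [->|P0] := eqVneq P 0; first by rewrite derivC size_poly0.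
    apply: leq_trans (ltnW (lt_size_deriv P0)) _.
    by apply: leq_trans (leq_maxr N _) _; do 3 apply: leqW.
  apply: leq_trans (size_scale_leq _ _) _.
  by apply: leq_trans (size_affine_leq _ _ _ _) (size_chebyshev _ _).1.
- rewrite map_inj_uniq// => x y /addIr /mulfI; apply; exact: lt0r_neq0.
- apply/allP => _ /mapP[r rin ->]; rewrite /root dp hornerD hornerZ horner_affine.
  by rewrite kcl; have := allP rrs r rin; rewrite /root !hornerE horner_affine.
- exact/eqP.
by exists (c * r + d) => //; apply/cdb/brs.
Qed.

(** * Moduli of continuity *)

(* The form [e + K (x - y)^2] is what the second moment of the
   binomial distribution controls. *)
Lemma continuous_quadratic_modulus (R : realType) (a b e : R) (f : R -> R) :
  {within `[a, b], continuous f} -> 0 < e ->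
  exists2 K, 0 <= K &
    {in `[a, b] &, forall x y, `|f x - f y| <= e + K * (x - y) ^+ 2}.
Proof.
move=> cf e0.
have [M [_ fM]] := compact_bounded (continuous_compact cf (@segment_compact R a b)).
(* Boundedness supplies a bound for each real strictly above [M]. *)
pose B := `|M| + 1.
have B0 : 0 < B by rewrite ltr_pwDr.
have fB x : x \in `[a, b] -> `|f x| <= B.
  move=> xab; apply: (fM B); last by exists x.
  by rewrite /B (le_lt_trans (ler_norm M)) ?ltrDl.
have /compact_near_coveringP/near_covering_withinP cov := @segment_compact R a b.
(* Compactness reduces a common [K] to a local claim: near each [x], all large [K] work. *)
suff : \forall K \near +oo, `[a, b]%classic `<=` [set x | forall y, y \in `[a, b] ->
    `|f x - f y| <= e + K * (x - y) ^+ 2].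
  move=> near_K; have [K [K0 HK]] : exists K : R, 0 <= K /\
      `[a, b]%classic `<=` [set x | forall y, y \in `[a, b] ->
        `|f x - f y| <= e + K * (x - y) ^+ 2].
    near (pinfty_nbhs R) => K; exists K; split; last by near: K.
    by near: K; exact: nbhs_pinfty_ge.
  by exists K => // x y xab yab; exact: HK.
apply: cov => x xab.
have /subspace_continuousP/(_ x xab)/cvgrPdist_lt/(_ (e / 2)) := cf.
rewrite divr_gt0// => /(_ isT); rewrite /prop_near1/= => -[d /= d0 fd].
have d20 : 0 < d / 2 by rewrite divr_gt0.
near=> y K => yab z zab /=.
have K0 : 0 <= K by near: K; apply: nbhs_pinfty_ge; rewrite num_real.
have xy : `|x - y| < d / 2 by near: y; exact: nbhsx_ballx.
have fxy : `|f x - f y| < e / 2.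
  by apply: fd => //=; apply: lt_trans xy _; rewrite ltr_pdivrMr// ltr_pMr// ltr1n.
(* If [z] is close to [y], both are within [d] of [x] and continuity gives [e]; otherwise
   [K (d / 2)^2] already exceeds the oscillation bound [2 B]. *)
have [yz|yz] := ltP `|y - z| (d / 2).
  have fxz : `|f x - f z| < e / 2.
    apply: fd => //=; rewrite -(subrK y x) -addrA (le_lt_trans (ler_normD _ _))//.
    by rewrite [ltRHS]splitr ltrD.
  rewrite (@le_trans _ _ e) ?lerDl ?(mulr_ge0 K0 (sqr_ge0 _))//.
  rewrite -(subrK (f x) (f y)) -addrA (le_trans (ler_normD _ _))// [leRHS]splitr.
  by rewrite lerD ?ltW// distrC.
have KB : B *+ 2 / (d / 2) ^+ 2 <= K.
  by near: K; apply: nbhs_pinfty_ge; rewrite num_real.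
apply: le_trans (ler_normB _ _) _; apply: (@le_trans _ _ (B *+ 2)).
  by rewrite mulr2n lerD// fB.
rewrite ler_wpDl ?(ltW e0)//; move: KB; rewrite ler_pdivrMr ?exprn_gt0// => KB.
apply: le_trans KB _; rewrite ler_wpM2l// -[leRHS]real_normK ?num_real//.
by rewrite ler_pXn2r ?nnegrE ?(ltW d20).
Unshelve. all: by end_near. Qed.

(** With [u = A |s|], this is [u e <= e^2 + u^2] divided by [e]. *)
Lemma lipschitz_quadratic_modulus (R : realType) (A e s : R) :
  0 < e -> A * `|s| <= e + A ^+ 2 / e * s ^+ 2.
Proof.
move=> e0; rewrite -(real_normK (num_real s)); set t := `|s|.
have -> : A ^+ 2 / e * t ^+ 2 = (A * t) ^+ 2 / e by field; rewrite gt_eqF.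
rewrite -lerBlDl ler_pdivlMr//; nra.
Qed.

(** * Lipschitz and supremum bounds, and the conclusion *)

Lemma poly_lipschitz (R : realType) (a b L : R) (p : {poly R}) :
  {in `[a, b], forall x, `|p^`().[x]| <= L} ->
  L.-lipschitz_(`[a, b]) (fun x : R => p.[x]).
Proof.
move=> pL [x y] [/= xab yab].
wlog xy : x y xab yab / x < y => [hw|].
  have [xy|yx|->] := ltgtP x y; first exact: hw.
    by rewrite distrC (distrC x); exact: hw.
  by rewrite !subrr normr0 mulr0.
rewrite distrC (distrC x); have [z zxy ->] := poly_mvt p xy.
rewrite normrM ler_wpM2r// pL//; move: zxy xab yab; rewrite !in_itv /=.
move=> /andP[xz zy] /andP[ax _] /andP[_ yb].
by rewrite (le_trans ax (ltW xz)) (le_trans (ltW zy) yb).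
Qed.

(** The gap between [d] and [e] keeps the inequality strict after passing to the supremum; [a <= b]
    makes the set of values nonempty. *)
Lemma supnorm_lt (R : realType) (a b d e : R) (g : R -> R) :
  a <= b -> d < e -> {in `[a, b], forall x, `|g x| <= d} ->
  supnorm `[a, b] g < e.
Proof.
move=> ab de gd; apply: le_lt_trans de; apply: ge_sup.
  by exists `|g a|, a => //=; rewrite in_itv /= lexx.
by move=> _ [x xab <-]; exact: gd.
Qed.

Theorem theorem1p1 (R : realType) :
  exists C : R,
    forall (a b : R) (f : R -> R),
      a <= b ->
      {within `[a, b], continuous f} ->
      forall eps : R, 0 < eps ->
        (exists p : {poly R},
            supnorm `[a, b] (fun x => f x - p.[x]) < eps
            /\ CP (complex_poly p) `<=` complex_set `[a, b])
        /\
        (forall A : R, 0 < A ->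
            A.-lipschitz_(`[a, b]) f ->
            exists p : {poly R},
              [/\ supnorm `[a, b] (fun x => f x - p.[x]) < eps,
                  CP (complex_poly p) `<=` complex_set `[a, b]
                & (C * A).-lipschitz_(`[a, b]) (fun x : R => p.[x])]).
Proof.
exists 4 => a b f; rewrite le_eqVlt => /predU1P[<- _ eps eps0|ab cf eps eps0].
  (* On a one-point interval a polynomial of degree 1 has no critical point, whereas for a constant
     every complex number would be one. *)
  pose p : {poly R} := 'X + (f a - a)%:P.
  have pf : supnorm `[a, a] (fun x => f x - p.[x]) < eps.
    apply: (@supnorm_lt R a a 0) => // x; rewrite in_itv /= => /le_anti <-.
    by rewrite hornerD hornerX hornerC [a + _]addrC subrK subrr normr0.
  have CPp : CP (complex_poly p) `<=` complex_set `[a, a].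
    move=> z; rewrite /CP /= /complex_poly deriv_map derivD derivX derivC addr0.
    by rewrite rmorph1 hornerC => /eqP; rewrite oner_eq0.
  split=> [|A A0 _]; exists p; split=> //.
  move=> [x y] [/=]; rewrite !in_itv /= => /le_anti <- /le_anti <-.
  by rewrite !subrr normr0 mulr0.
(* The Bernstein error [2 e] and the Chebyshev error [e] add up to [3 e < eps]. *)
pose e := eps / 8; have e0 : 0 < e by rewrite divr_gt0.
have close P p : {in `[a, b], forall x, `|f x - P.[x]| <= e *+ 2} ->
    {in `[a, b], forall x, `|P.[x] - p.[x]| <= e} ->
    supnorm `[a, b] (fun x => f x - p.[x]) < eps.
  move=> fP Pp; apply: (@supnorm_lt _ _ _ (e *+ 3)); first exact: ltW.
    by rewrite /e; lra.
  move=> x xab; rewrite -(subrK P.[x] (f x)) -addrA.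
  by rewrite (le_trans (ler_normD _ _))// mulrSr lerD ?fP ?Pp.
split=> [|A A0 fA].
  have [K K0 fK] := continuous_quadratic_modulus _ _ _ _ _ cf e0.
  have [P [fP _]] := bernstein_approx _ _ _ _ _ _ ab e0 K0 fK.
  have [M PM] := poly_itv_bound P^`() a b.
  have [x xab|p [Pp _ CPp]] := @real_critical_approx R a b (M + 1) e P ab e0.
    by rewrite (le_lt_trans (PM x xab))// ltrDl.
  by exists p; split=> //; exact: (close P p).
have fA' : {in `[a, b] &, forall x y, `|f x - f y| <= A * `|x - y|}.
  by move=> x y xab yab; exact: (fA (x, y)).
have K0 : 0 <= A ^+ 2 / e by rewrite divr_ge0 ?sqr_ge0// ltW.
have fK : {in `[a, b] &, forall x y,
    `|f x - f y| <= e + A ^+ 2 / e * (x - y) ^+ 2}.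
  move=> x y xab yab; apply: le_trans (fA' x y xab yab) _.
  exact: lipschitz_quadratic_modulus.
have [P [fP PA]] := bernstein_approx _ _ _ _ _ _ ab e0 K0 fK.
(* The bound on [P'] must be strict, so [D] has to exceed [A]; then [|p'| <= 2 D = 4 A]. *)
have [x xab|p [Pp pL CPp]] := @real_critical_approx R a b (A *+ 2) e P ab e0.
  by rewrite (le_lt_trans (PA A fA' x xab))// mulr2n ltrDl.
exists p; split=> //; first exact: (close P p).
by apply: poly_lipschitz => x /pL; rewrite -mulrnA mulr_natl.
Qed.
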